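(* Let $w=(w(n))_{n\in\mathbb{N}}$ be a bounded, strictly positive sequence such that $\mathsf{C}^{(1,w)}\in\mathcal{L}(\ell_1(w))$. (i) The following inclusions hold: $\Sigma\subseteq\Sigma_0\subseteq\sigma(\mathsf{C}^{(1,w)})$. (ii) Let $\lambda\in\mathbb{C}$ with $\lambda\notin\Sigma_0$ and set $\alpha:=\mathrm{Re}\left(\frac1\lambda\right)$. Then $\lambda\in\rho(\mathsf{C}^{(1,w)})$ if and only if $$\sup_{m\in\mathbb{N}}\frac{1}{m^\alpha w(m)}\sum_{n=m+1}^\infty\frac{w(n)}{n^{1-\alpha}}<\infty.$$ (iii) Suppose that $R_w\neq\mathbb{R}$, i.e., $t_0<\infty$. Then $$\left\{\tfrac1m\colon m\in\mathbb{N},\ (m-1)\in R_w\right\}=\sigma_{pt}(\mathsf{C}^{(1,w)})\subseteq\left\{\tfrac1m\colon m\in\mathbb{N},\ 1\le m\le t_0+1\right\}.$$ In particular, $\sigma_{pt}(\mathsf{C}^{(1,w)})$ is a finite (possibly empty) subset of $\Sigma$. If $R_w=\mathbb{R}$, then $\sigma_{pt}(\mathsf{C}^{(1,w)})=\Sigma$.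
   Context: The discrete Cesàro operator $\mathsf{C}\colon\mathbb{C}^{\mathbb{N}}\to\mathbb{C}^{\mathbb{N}}$ is the linear map $\mathsf{C}x:=\left(\frac{x_1+\dots+x_n}{n}\right)_{n\in\mathbb{N}}$ for $x=(x_n)_{n\in\mathbb{N}}$, with $\mathbb{N}=\{1,2,\dots\}$. For a bounded, strictly positive sequence $w$, $\ell_1(w):=\{x\in\mathbb{C}^{\mathbb{N}}\colon \sum_{n=1}^\infty w(n)|x_n|<\infty\}$, a Banach space for the norm $\|x\|_{1,w}:=\sum_{n=1}^\infty w(n)|x_n|$. $\mathcal{L}(X)$ is the space of continuous linear operators on a Banach space $X$. Writing $\mathsf{C}^{(1,w)}\in\mathcal{L}(\ell_1(w))$ means that $\mathsf{C}$ maps $\ell_1(w)$ continuously into itself, and $\mathsf{C}^{(1,w)}$ denotes the restriction of $\mathsf{C}$ to $\ell_1(w)$. $\sigma(T)$, $\rho(T)$, $\sigma_{pt}(T)$ denote the spectrum, resolvent set and set of eigenvalues (point spectrum) of $T\in\mathcal{L}(X)$. Further, $\Sigma:=\{\frac1m\colon m\in\mathbb{N}\}$, $\Sigma_0:=\Sigma\cup\{0\}$, $R_w:=\{t\in\mathbb{R}\colon\sum_{n=1}^\infty n^tw(n)<\infty\}$ and $t_0:=\sup R_w$. *)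

(* Defs.v *)
From Stdlib Require Import Reals Lra ProofIrrelevance FunctionalExtensionality.
From Coquelicot Require Import Coquelicot.

Open Scope R_scope.

(* Sequences indexed by N = {1, 2, ...} are represented as functions on [nat]
   shifted by one: the n-th term (n >= 1) of x is [x (n - 1)], equivalently
   [x k] is the term of index [S k]. *)

Record weight : Type := Weight {
  weight_fun :> nat -> R;
  weight_pos : forall k, 0 < weight_fun k;
  weight_bounded : exists M, forall k, weight_fun k <= M
}.

Definition in_ell1 (w : weight) (x : nat -> C) : Prop :=
  ex_series (fun k => w k * Cmod (x k)).

Record ell1 (w : weight) : Type := Ell1 {
  ell1_seq :> nat -> C;
  ell1_in : in_ell1 w ell1_seq
}.

Arguments Ell1 {w} _ _.
Arguments ell1_seq {w} _ _.
Arguments ell1_in {w} _.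

Definition ell1_norm (w : weight) (x : ell1 w) : R :=
  Series (fun k => w k * Cmod (x k)).

Lemma Series_zero (a : nat -> R) : (forall k, a k = 0) -> Series a = 0.
Proof.
intros h; rewrite (Series_ext a (fun k => 0 * a k)); [now rewrite Series_scal_l, Rmult_0_l | ].
intros k; rewrite h; ring.
Qed.

Section Ell1Structure.

Variable w : weight.
Implicit Types (x y z : ell1 w) (a b : C).

Lemma ell1_ext x y : (forall k, x k = y k) -> x = y.
Proof.
destruct x as [x hx], y as [y hy]; simpl; intros h.
assert (e : x = y) by (apply functional_extensionality; exact h).
subst y; f_equal; apply proof_irrelevance.
Qed.

Lemma ell1_term_ge0 (u : nat -> C) k : 0 <= w k * Cmod (u k).
Proof.
apply Rmult_le_pos; [left; apply weight_pos | apply Cmod_ge_0].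
Qed.

Lemma in_ell1_zero : in_ell1 w (fun _ => RtoC 0).
Proof.
exists (0 : R); apply (is_lim_seq_ext (fun _ => 0) _ (Finite 0)); [ | apply is_lim_seq_const].
intros n; rewrite (sum_n_ext _ (fun _ => 0)), sum_n_const; [ring | ].
intros k; rewrite Cmod_0; apply Rmult_0_r.
Qed.

Lemma in_ell1_dominated (u : nat -> C) (b : nat -> R) :
  (forall k, Cmod (u k) <= b k) -> ex_series (fun k => w k * b k) -> in_ell1 w u.
Proof.
intros h hb; apply (ex_series_le (K := R_AbsRing) (V := R_CompleteNormedModule))
  with (2 := hb).
intros k; change (Rabs (w k * Cmod (u k)) <= w k * b k).
rewrite Rabs_pos_eq by apply ell1_term_ge0.
apply Rmult_le_compat_l; [left; apply weight_pos | apply h].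
Qed.

Lemma ex_series_ell1_add x y : ex_series (fun k => w k * (Cmod (x k) + Cmod (y k))).
Proof.
apply ex_series_ext with
  (fun k => plus (w k * Cmod (x k) : R) (w k * Cmod (y k))).
  intros k; unfold plus; simpl; ring.
apply (ex_series_plus (K := R_AbsRing) (V := R_NormedModule)); apply ell1_in.
Qed.

Lemma in_ell1_add x y : in_ell1 w (fun k => (x k + y k)%C).
Proof.
apply in_ell1_dominated with (2 := ex_series_ell1_add x y).
intros k; apply Cmod_triangle.
Qed.

Lemma in_ell1_opp x : in_ell1 w (fun k => (- x k)%C).
Proof.
apply in_ell1_dominated with (2 := ell1_in x).
intros k; rewrite Cmod_opp; apply Rle_refl.
Qed.

Lemma in_ell1_scal a x : in_ell1 w (fun k => (a * x k)%C).
Proof.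
apply in_ell1_dominated with (b := fun k => Cmod a * Cmod (x k)).
  intros k; rewrite Cmod_mult; apply Rle_refl.
apply ex_series_ext with (fun k => scal (Cmod a : R) (w k * Cmod (x k) : R)).
  intros k; unfold scal; simpl; unfold mult; simpl; ring.
apply (ex_series_scal (K := R_AbsRing) (V := R_NormedModule)); apply ell1_in.
Qed.

Definition ell1_zero : ell1 w := Ell1 (fun _ => RtoC 0) in_ell1_zero.
Definition ell1_add x y : ell1 w := Ell1 (fun k => (x k + y k)%C) (in_ell1_add x y).
Definition ell1_opp x : ell1 w := Ell1 (fun k => (- x k)%C) (in_ell1_opp x).
Definition ell1_scal a x : ell1 w := Ell1 (fun k => (a * x k)%C) (in_ell1_scal a x).

Definition ell1_AbelianMonoid_mixin : AbelianMonoid.mixin_of (ell1 w).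
Proof.
apply (AbelianMonoid.Mixin _ ell1_add ell1_zero).
- intros x y; apply ell1_ext; intros k; simpl; ring.
- intros x y z; apply ell1_ext; intros k; simpl; ring.
- intros x; apply ell1_ext; intros k; simpl; ring.
Defined.

Canonical ell1_AbelianMonoid :=
  AbelianMonoid.Pack (ell1 w) ell1_AbelianMonoid_mixin (ell1 w).

Definition ell1_AbelianGroup_mixin : AbelianGroup.mixin_of ell1_AbelianMonoid.
Proof.
apply (AbelianGroup.Mixin ell1_AbelianMonoid ell1_opp).
intros x; apply ell1_ext; intros k; simpl; ring.
Defined.

Canonical ell1_AbelianGroup :=
  AbelianGroup.Pack (ell1 w)
    (AbelianGroup.Class _ ell1_AbelianMonoid_mixin ell1_AbelianGroup_mixin) (ell1 w).

Definition ell1_ModuleSpace_mixin : ModuleSpace.mixin_of C_Ring ell1_AbelianGroup.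
Proof.
apply (ModuleSpace.Mixin C_Ring ell1_AbelianGroup ell1_scal).
- intros a b x; apply ell1_ext; intros k; simpl; unfold mult; simpl; ring.
- intros x; apply ell1_ext; intros k; simpl; unfold one; simpl; ring.
- intros a x y; apply ell1_ext; intros k; simpl; ring.
- intros a b x; apply ell1_ext; intros k; simpl; unfold plus; simpl; ring.
Defined.

Canonical ell1_ModuleSpace :=
  ModuleSpace.Pack C_Ring (ell1 w)
    (ModuleSpace.Class _ _ _ ell1_ModuleSpace_mixin) (ell1 w).

Lemma ell1_norm_triangle x y :
  ell1_norm w (ell1_add x y) <= ell1_norm w x + ell1_norm w y.
Proof.
unfold ell1_norm; rewrite <- Series_plus by apply ell1_in.
apply Series_le.
- intros k; split; [apply ell1_term_ge0 | ].
  simpl; rewrite <- Rmult_plus_distr_l.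
  apply Rmult_le_compat_l; [left; apply weight_pos | apply Cmod_triangle].
- apply (ex_series_plus (K := R_AbsRing) (V := R_NormedModule)); apply ell1_in.
Qed.

Lemma ell1_norm_scal a x : ell1_norm w (ell1_scal a x) = Cmod a * ell1_norm w x.
Proof.
unfold ell1_norm; rewrite <- Series_scal_l; apply Series_ext.
intros k; simpl; rewrite Cmod_mult; ring.
Qed.

Lemma ell1_norm_opp x : ell1_norm w (ell1_opp x) = ell1_norm w x.
Proof.
unfold ell1_norm; apply Series_ext; intros k; simpl; now rewrite Cmod_opp.
Qed.

Lemma ell1_norm_zero : ell1_norm w ell1_zero = 0.
Proof.
unfold ell1_norm; rewrite Series_zero; [reflexivity | ].
intros k; simpl; rewrite Cmod_0; ring.
Qed.

Lemma ell1_term_le_norm x k : w k * Cmod (x k) <= ell1_norm w x.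
Proof.
unfold ell1_norm; rewrite (Series_incr_n _ (S k)); [ | apply Nat.lt_0_succ | apply ell1_in].
simpl pred.
assert (h1 : w k * Cmod (x k) <= sum_f_R0 (fun k => w k * Cmod (x k)) k).
{ destruct k as [ | k]; simpl; [apply Rle_refl | ].
  assert (h := cond_pos_sum (fun k => w k * Cmod (x k)) k (ell1_term_ge0 x)); lra. }
assert (h2 : 0 <= Series (fun j => w (S k + j)%nat * Cmod (x (S k + j)%nat))).
{ rewrite <- (Series_zero (fun _ => 0)) by reflexivity.
  apply Series_le.
  - intros j; split; [apply Rle_refl | apply ell1_term_ge0].
  - apply (ex_series_incr_n (fun k => w k * Cmod (x k)) (S k)); apply ell1_in. }
lra.
Qed.

Lemma ell1_norm_eq0 x : ell1_norm w x = 0 -> x = ell1_zero.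
Proof.
intros h; apply ell1_ext; intros k; simpl; apply Cmod_eq_0.
assert (h1 := ell1_term_le_norm x k); rewrite h in h1.
assert (h2 := ell1_term_ge0 x k).
destruct (Rmult_integral (w k) (Cmod (x k))) as [e | e]; [lra | | exact e].
assert (h3 := weight_pos w k); lra.
Qed.

Definition ell1_ball x (e : R) y : Prop := ell1_norm w (ell1_add y (ell1_opp x)) < e.

Definition ell1_UniformSpace_mixin : UniformSpace.mixin_of (ell1 w).
Proof.
apply (UniformSpace.Mixin _ ell1_zero ell1_ball); unfold ell1_ball.
- intros x e.
  replace (ell1_add x (ell1_opp x)) with ell1_zero.
    rewrite ell1_norm_zero; apply cond_pos.
  apply ell1_ext; intros k; simpl; ring.
- intros x y e h; rewrite <- ell1_norm_opp.
  replace (ell1_opp (ell1_add x (ell1_opp y))) with (ell1_add y (ell1_opp x)).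
    exact h.
  apply ell1_ext; intros k; simpl; ring.
- intros x y z e1 e2 h1 h2.
  replace (ell1_add z (ell1_opp x))
    with (ell1_add (ell1_add y (ell1_opp x)) (ell1_add z (ell1_opp y))).
    apply Rle_lt_trans with (1 := ell1_norm_triangle _ _); lra.
  apply ell1_ext; intros k; simpl; ring.
Defined.

Canonical ell1_UniformSpace :=
  UniformSpace.Pack (ell1 w) ell1_UniformSpace_mixin (ell1 w).

Canonical ell1_NormedModuleAux :=
  NormedModuleAux.Pack C_AbsRing (ell1 w)
    (NormedModuleAux.Class C_AbsRing _ (ModuleSpace.class _ ell1_ModuleSpace)
       ell1_UniformSpace_mixin) (ell1 w).

Definition ell1_NormedModule_mixin :
  NormedModule.mixin_of C_AbsRing ell1_NormedModuleAux.
Proof.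
apply (NormedModule.Mixin C_AbsRing ell1_NormedModuleAux (ell1_norm w) 1).
- exact ell1_norm_triangle.
- intros a x; apply Req_le; exact (ell1_norm_scal a x).
- intros x y e h; exact h.
- intros x y e h; rewrite Rmult_1_l; exact h.
- exact ell1_norm_eq0.
Defined.

Canonical ell1_NormedModule :=
  NormedModule.Pack C_AbsRing (ell1 w)
    (NormedModule.Class _ _ _ ell1_NormedModule_mixin) (ell1 w).

End Ell1Structure.

(* [is_linear] is Coquelicot's notion of a bounded (continuous) linear map. *)
Definition resolvent_set {X : NormedModule C_AbsRing} (T : X -> X) (l : C) : Prop :=
  exists S : X -> X, is_linear S /\
    (forall x, S (minus (scal l x) (T x)) = x) /\
    (forall x, minus (scal l (S x)) (T (S x)) = x).

Definition spectrum {X : NormedModule C_AbsRing} (T : X -> X) (l : C) : Prop :=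
  ~ resolvent_set T l.

Definition point_spectrum {X : NormedModule C_AbsRing} (T : X -> X) (l : C) : Prop :=
  exists x : X, x <> zero /\ T x = scal l x.

Definition cesaro (x : nat -> C) (k : nat) : C :=
  (sum_n x k / RtoC (INR (S k)))%C.

Definition cesaro_ell1 (w : weight)
  (h : forall x : nat -> C, in_ell1 w x -> in_ell1 w (cesaro x)) (x : ell1 w) : ell1 w :=
  Ell1 (cesaro x) (h x (ell1_in x)).

Definition Sigma (l : C) : Prop :=
  exists m : nat, (1 <= m)%nat /\ l = RtoC (1 / INR m).

Definition Sigma0 (l : C) : Prop := Sigma l \/ l = RtoC 0.

Definition R_w (w : weight) (t : R) : Prop :=
  ex_series (fun k => Rpower (INR (S k)) t * w k).

Definition t_0 (w : weight) : Rbar := Lub_Rbar (R_w w).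

(* Value in [0, +oo] of a series with nonnegative terms: the partial sums are
   nondecreasing, so [Lim_seq] is their limit even when it is infinite. *)
Definition nonneg_series (a : nat -> R) : Rbar := Lim_seq (sum_n a).

(* sup over m >= 1 of (m^alpha w(m))^-1 * sum_(n >= m+1) w(n) / n^(1-alpha),
   with m = S k and n = m + 1 + j = S (S k + j). *)
Definition resolvent_sup (w : weight) (alpha : R) : Rbar :=
  Sup_seq (fun k : nat =>
    Rbar_mult (Finite (1 / (Rpower (INR (S k)) alpha * w k)))
      (nonneg_series (fun j : nat =>
         w (S k + j)%nat / Rpower (INR (S (S k + j))) (1 - alpha)))).

(* Main.v *)
(** Put [b = 1/l] and [p_n = prod_(1 <= j <= n) (1 - b/j)].  If [l x - C x = y] and
    [s_n = x_0 + ... + x_n], then [p_(n+1) s_n = b sum_(j <= n) p_j y_j].  When [b] is not a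
    positive integer this determines the lower triangular matrix of [(l - C)^-1], and
    [|p_n|] is comparable to [n^-alpha], [alpha = Re b]; since the norm of a matrix operator on
    [l1(w)] is the supremum of the normalized norms of its columns, boundedness is the stated
    supremum condition.  If [l = 1/m], then [p_m = 0] and the [m]-th unit vector is not in the
    range of [l - C]; if [l = 0], the inverse would send the [n]-th unit vector to one with
    [n]-th entry of modulus [n], hence be unbounded.  Finally, an eigenvector whose first nonzero
    entry has index [m] (counted from 0) has eigenvalue [1/(m+1)] and is proportional to the
    falling factorial [k (k-1) ... (k-m+1)], which grows like [k^m]. *)

Require Import Defs.
From Stdlib Require Import Reals List Lra Lia Arith Classical.
From Coquelicot Require Import Coquelicot.

Open Scope R_scope.

(** * Nonnegative series and boundedness of real sequences *)

Lemma INR_S_pos (n : nat) : 0 < INR (S n).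
Proof. apply lt_0_INR; lia. Qed.

Lemma RtoC_INR_S_neq0 (n : nat) : RtoC (INR (S n)) <> RtoC 0.
Proof. intros h; apply RtoC_inj in h; assert (h1 := INR_S_pos n); lra. Qed.

Lemma Rpower_pos (x y : R) : 0 < Rpower x y.
Proof. apply exp_pos. Qed.

Lemma exp_le_compat (x y : R) : x <= y -> exp x <= exp y.
Proof.
intros [h | ->]; [left; now apply exp_increasing | apply Rle_refl].
Qed.

Lemma sum_n_nonneg_incr (a : nat -> R) :
  (forall k, 0 <= a k) -> forall n, sum_n a n <= sum_n a (S n).
Proof.
intros h n; rewrite sum_Sn; unfold plus; simpl; specialize (h (S n)); lra.
Qed.

Lemma nonneg_series_bounded (a : nat -> R) (B : R) :
  (forall k, 0 <= a k) -> (forall n, sum_n a n <= B) ->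
  ex_series a /\ Series a <= B.
Proof.
intros h hB.
assert (e : ex_series a).
{ destruct (ex_finite_lim_seq_incr (sum_n a) B) as [l hl].
  - now apply sum_n_nonneg_incr.
  - exact hB.
  - exists l; exact hl. }
split; [exact e | ].
assert (h1 : is_lim_seq (sum_n a) (Series a)) by exact (Series_correct _ e).
exact (is_lim_seq_le _ (fun _ => B) _ (Finite B) hB h1 (is_lim_seq_const B)).
Qed.

Lemma sum_n_le_Series (a : nat -> R) (n : nat) :
  (forall k, 0 <= a k) -> ex_series a -> sum_n a n <= Series a.
Proof.
intros h e; apply (is_lim_seq_incr_compare (sum_n a)).
- apply Series_correct, e.
- now apply sum_n_nonneg_incr.
Qed.

Lemma sum_n_shift_le_Series (a : nat -> R) (m n : nat) :
  (forall k, 0 <= a k) -> ex_series a ->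
  sum_n (fun j => a (m + j)%nat) n <= Series a.
Proof.
intros h e; apply Rle_trans with (sum_n a (m + n)%nat); [ | now apply sum_n_le_Series].
induction n as [ | n IH].
- rewrite sum_O, Nat.add_0_r; destruct m as [ | m].
  + rewrite sum_O; apply Rle_refl.
  + rewrite sum_Sn; unfold plus; simpl.
    assert (h1 : 0 <= sum_n a m); [ | lra].
    clear -h; induction m as [ | m IH].
    * rewrite sum_O; apply h.
    * assert (h1 := sum_n_nonneg_incr a h m); lra.
- rewrite Nat.add_succ_r, !sum_Sn, Nat.add_succ_r; unfold plus; simpl; lra.
Qed.

Lemma bounded_of_eventually (L : nat -> R) (N : nat) (B : R) :
  (forall n, (N <= n)%nat -> Rabs (L n) <= B) -> exists B', forall n, Rabs (L n) <= B'.
Proof.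
revert B; induction N as [ | N IH]; intros B h.
- exists B; intros n; apply h; lia.
- apply (IH (Rmax B (Rabs (L N)))); intros n hn.
  destruct (Nat.eq_dec n N) as [-> | d]; [apply Rmax_r | ].
  apply Rle_trans with (2 := Rmax_l _ _); apply h; lia.
Qed.

Lemma bounded_of_increments (L : nat -> R) (N : nat) (K : R) :
  0 <= K ->
  (forall n, (N <= n)%nat -> Rabs (L (S n) - L n) <= K / INR (S n) ^ 2) ->
  exists B, forall n, Rabs (L n) <= B.
Proof.
intros hK h.
(* [1/n^2 <= 2/n - 2/(n+1)] makes the bounds on the increments telescope. *)
assert (h1 : forall j, Rabs (L (N + j)%nat)
   <= Rabs (L N) + 2 * K / INR (S N) - 2 * K / INR (S (N + j))).
{ induction j as [ | j IH].
  - rewrite Nat.add_0_r; lra.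
  - rewrite Nat.add_succ_r.
    assert (h2 := h (N + j)%nat ltac:(lia)).
    assert (h3 := Rabs_triang (L (S (N + j)) - L (N + j)%nat) (L (N + j)%nat)).
    replace (L (S (N + j)) - L (N + j)%nat + L (N + j)%nat) with (L (S (N + j))) in h3 by ring.
    assert (h4 : K / INR (S (N + j)) ^ 2 <=
       2 * K / INR (S (N + j)) - 2 * K / INR (S (S (N + j)))).
    { rewrite (S_INR (S _)); set (x := INR (S (N + j))).
      assert (hx : 1 <= x) by (unfold x; rewrite S_INR; assert (hp := pos_INR (N + j)); lra).
      replace (2 * K / x - 2 * K / (x + 1)) with (K / x ^ 2 * (2 * x / (x + 1))) by (field; lra).
      rewrite <- (Rmult_1_r (K / x ^ 2)) at 1.
      apply Rmult_le_compat_l.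
      - apply Rdiv_le_0_compat; [exact hK | apply pow_lt; lra].
      - apply (Rmult_le_reg_r (x + 1)); [lra | ].
        unfold Rdiv; rewrite Rmult_assoc, Rinv_l; lra. }
    lra. }
apply (bounded_of_eventually L N (Rabs (L N) + 2 * K / INR (S N))).
intros n hn; replace n with (N + (n - N))%nat by lia.
specialize (h1 (n - N)%nat).
assert (h2 : 0 <= 2 * K / INR (S (N + (n - N)))); [ | lra].
apply Rdiv_le_0_compat; [lra | apply INR_S_pos].
Qed.

(** * Growth of the products p_n *)

(** Both sides come from ln(1 + v) <= v: directly for v = u, and with v = 1/(1+u) - 1 for the lower
    bound. *)
Lemma ln_1p_bound (u : R) : Rabs u <= 1 / 2 -> Rabs (ln (1 + u) - u) <= 2 * u ^ 2.
Proof.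
intros hu; apply Rabs_le_between in hu.
assert (up : forall v, 0 < 1 + v -> ln (1 + v) <= v).
{ intros v hv; rewrite <- (ln_exp v) at 2; apply ln_le; [exact hv | apply exp_ineq1_le]. }
assert (h1 := up u ltac:(lra)).
assert (h2 : u - 2 * u ^ 2 <= ln (1 + u)).
{ assert (h3 := up (/ (1 + u) - 1)).
  replace (1 + (/ (1 + u) - 1)) with (/ (1 + u)) in h3 by ring.
  assert (h4 : 0 < / (1 + u)) by (apply Rinv_0_lt_compat; lra).
  specialize (h3 h4); rewrite ln_Rinv in h3 by lra.
  assert (h5 : u - 2 * u ^ 2 <= 1 - / (1 + u)).
  { replace (1 - / (1 + u)) with (u - u ^ 2 * / (1 + u)) by (field; lra).
    assert (h6 : / (1 + u) <= 2).
    { replace 2 with (/ (1 / 2)) by field; apply Rinv_le_contravar; lra. }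
    assert (h7 := pow2_ge_0 u).
    assert (h8 := Rmult_le_compat_l _ _ _ h7 h6); lra. }
  lra. }
assert (h3 := pow2_ge_0 u).
apply Rabs_le; lra.
Qed.

(** Since |1 - bt|^2 = 1 + u with u = -2 Re(b) t + |b|^2 t^2, the logarithm ln |1 - bt| is u/2 up to
    O(u^2), that is -Re(b) t up to O(t^2). This cancels the first-order term of Re(b) ln(1 + t). The
    third hypothesis ensures |u| <= 1/2. *)
Lemma ln_Cmod_increment (b : C) (t : R) :
  0 < t -> t <= 1 / 2 -> (2 * Cmod b + Cmod b ^ 2) * t <= 1 / 2 ->
  (1 - b * RtoC t)%C <> RtoC 0 ->
  Rabs (ln (Cmod (1 - b * RtoC t)) + Re b * ln (1 + t))
    <= ((2 * Cmod b + Cmod b ^ 2) ^ 2 + Cmod b ^ 2 + 2 * Cmod b) * t ^ 2.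
Proof.
intros ht ht2 hs hz.
set (B := Cmod b) in *.
assert (hB : 0 <= B) by apply Cmod_ge_0.
assert (ha : Rabs (Re b) <= B) by apply re_le_Cmod.
set (u := - 2 * Re b * t + B ^ 2 * t ^ 2).
assert (hm : Cmod (1 - b * RtoC t) ^ 2 = 1 + u).
{ unfold u, B; rewrite !Cmod2_alt; destruct b as [x y]; simpl; ring. }
assert (hu : Rabs u <= (2 * B + B ^ 2) * t).
{ unfold u.
  apply Rle_trans with (1 := Rabs_triang _ _).
  rewrite !Rabs_mult, (Rabs_pos_eq t), (Rabs_pos_eq (B ^ 2)), (Rabs_pos_eq (t ^ 2)), Rabs_left
    by (try apply pow2_ge_0; lra).
  assert (h1 : Rabs (Re b) * t <= B * t) by (apply Rmult_le_compat_r; lra).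
  assert (h2 : B ^ 2 * t ^ 2 <= B ^ 2 * t).
  { apply Rmult_le_compat_l; [apply pow2_ge_0 | nra]. }
  lra. }
assert (hl : ln (1 + u) = 2 * ln (Cmod (1 - b * RtoC t))).
{ assert (hp := proj1 (Cmod_gt_0 _) hz).
  rewrite <- hm; simpl; rewrite Rmult_1_r, ln_mult by exact hp; ring. }
assert (h1 := ln_1p_bound u ltac:(lra)).
assert (h2 := ln_1p_bound t ltac:(rewrite Rabs_pos_eq; lra)).
assert (h3 : u ^ 2 <= ((2 * B + B ^ 2) * t) ^ 2).
{ rewrite <- (pow2_abs u); apply pow_incr; split; [apply Rabs_pos | exact hu]. }
replace (ln (Cmod (1 - b * RtoC t)) + Re b * ln (1 + t))
  with (/ 2 * (ln (1 + u) - u) + / 2 * B ^ 2 * t ^ 2 + Re b * (ln (1 + t) - t)).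
2: { rewrite hl; unfold u; field. }
assert (h4 : Rabs (Re b * (ln (1 + t) - t)) <= B * (2 * t ^ 2)).
{ rewrite Rabs_mult; apply Rmult_le_compat; auto using Rabs_pos. }
assert (h5 : Rabs (/ 2 * (ln (1 + u) - u)) <= u ^ 2).
{ rewrite Rabs_mult, (Rabs_pos_eq (/ 2)) by lra; lra. }
assert (h6 : 0 <= / 2 * B ^ 2 * t ^ 2) by (apply Rmult_le_pos; nra).
apply Rle_trans with (1 := Rabs_triang _ _).
apply Rle_trans with (1 := Rplus_le_compat_r _ _ _ (Rabs_triang _ _)).
rewrite (Rabs_pos_eq (/ 2 * B ^ 2 * t ^ 2)) by exact h6.
nra.
Qed.

(** The product p_n, which equals (-1)^n times the binomial coefficient of b - 1 over n. *)
Fixpoint cprod (b : C) (n : nat) : C :=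
  match n with
  | O => RtoC 1
  | S n => (cprod b n * (1 - b / RtoC (INR (S n))))%C
  end.

Lemma cprod_neq0 (b : C) (n : nat) :
  (forall m, (m < n)%nat -> b <> RtoC (INR (S m))) -> cprod b n <> RtoC 0.
Proof.
induction n as [ | n IH]; intros h; [exact C1_nz | ].
change (cprod b n * (1 - b / RtoC (INR (S n))) <> 0)%C.
apply Cmult_neq_0; [apply IH; intros m hm; apply h; lia | ].
intros e; apply (h n); [lia | ].
assert (hn := RtoC_INR_S_neq0 n).
replace b with (RtoC (INR (S n)) * (1 - (1 - b / RtoC (INR (S n)))))%C by (field; exact hn).
rewrite e; ring.
Qed.

(** The logarithmic form of the comparison of |p_n| with (n+1)^(-Re b). With t = 1/(n+1), the
    increments of the sequence are exactly ln |1 - bt| + Re(b) ln(1 + t), hence O(t^2) and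
    summable. *)
Lemma ln_cprod_bounded (b : C) :
  (forall m, b <> RtoC (INR (S m))) ->
  exists B, forall n, Rabs (ln (Cmod (cprod b n)) + Re b * ln (INR (S n))) <= B.
Proof.
intros hb.
assert (hp : forall n, 0 < Cmod (cprod b n)).
{ intros n; apply Cmod_gt_0, cprod_neq0; auto. }
set (D := 2 * Cmod b + Cmod b ^ 2).
assert (hD : 0 <= D) by (unfold D; assert (h := Cmod_ge_0 b); nra).
(* Beyond this N, t = 1/(n+1) satisfies both t <= 1/2 and D t <= 1/2, the smallness asked by
   [ln_Cmod_increment]. *)
destruct (INR_unbounded (2 + 2 * D)) as [N hN].
apply (bounded_of_increments _ N (D ^ 2 + Cmod b ^ 2 + 2 * Cmod b)).
{ assert (h := Cmod_ge_0 b); nra. }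
intros n hn.
assert (hx : 2 + 2 * D < INR (S n)).
{ apply Rlt_le_trans with (1 := hN); apply le_INR; lia. }
set (t := / INR (S n)).
assert (ht : 0 < t) by (apply Rinv_0_lt_compat, INR_S_pos).
assert (htx : t * INR (S n) = 1) by (apply Rinv_l; lra).
assert (e : (1 - b / RtoC (INR (S n)))%C = (1 - b * RtoC t)%C).
{ unfold t; rewrite RtoC_inv by lra; reflexivity. }
assert (hz : (1 - b * RtoC t)%C <> RtoC 0).
{ rewrite <- e; intros h; apply (cprod_neq0 b (S n)); [auto | ].
  simpl cprod; change (cprod b n * (1 - b / RtoC (INR (S n))) = 0)%C; rewrite h; ring. }
assert (ht1 : t * (2 + 2 * D) <= 1).
{ rewrite <- htx; apply Rmult_le_compat_l; lra. }
assert (ht2 : 0 <= D * t) by (apply Rmult_le_pos; lra).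
assert (ht3 : t <= 1 / 2) by lra.
assert (ht4 : D * t <= 1 / 2) by lra.
assert (h1 := ln_Cmod_increment b t ht ht3 ht4 hz).
fold D in h1.
assert (e1 : cprod b (S n) = (cprod b n * (1 - b * RtoC t))%C).
{ rewrite <- e; reflexivity. }
rewrite e1, Cmod_mult, ln_mult by (apply hp || apply Cmod_gt_0, hz).
replace (INR (S (S n))) with (INR (S n) * (1 + t)).
2: { rewrite (S_INR (S n)); lra. }
rewrite (ln_mult (INR (S n))) by lra.
replace (_ - _) with (ln (Cmod (1 - b * RtoC t)) + Re b * ln (1 + t)) by ring.
apply Rle_trans with (1 := h1); apply Req_le; unfold t; field; lra.
Qed.

(** The entries of the inverse matrix contain p_m / p_(n+1), so the growth of the products is needed
    as a two-sided estimate of this ratio. *)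
Lemma cprod_ratio (b : C) :
  (forall m, b <> RtoC (INR (S m))) ->
  exists K, 0 < K /\ forall m n,
    Cmod (cprod b m) / Cmod (cprod b (S n))
      <= K * (Rpower (INR (S n)) (Re b) / Rpower (INR (S m)) (Re b)) /\
    Rpower (INR (S n)) (Re b) / Rpower (INR (S m)) (Re b)
      <= K * (Cmod (cprod b m) / Cmod (cprod b (S n))).
Proof.
intros hb.
assert (hp : forall n, 0 < Cmod (cprod b n)).
{ intros n; apply Cmod_gt_0, cprod_neq0; auto. }
destruct (ln_cprod_bounded b hb) as [B hB].
set (a := Re b) in *.
(* [hB] pairs p_(n+1) with n + 2. Passing to n + 1 costs at most |a|, because 0 <= ln((x+1)/x) <= 1
   for x >= 1. *)
assert (h2 : forall n, Rabs (ln (Cmod (cprod b (S n))) + a * ln (INR (S n))) <= B + Rabs a).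
{ intros n.
  replace (_ + _) with ((ln (Cmod (cprod b (S n))) + a * ln (INR (S (S n))))
    + - (a * (ln (INR (S (S n))) - ln (INR (S n))))) by ring.
  apply Rle_trans with (1 := Rabs_triang _ _), Rplus_le_compat; [apply hB | ].
  rewrite Rabs_Ropp, Rabs_mult, <- Rmult_1_r.
  apply Rmult_le_compat_l; [apply Rabs_pos | ].
  rewrite <- ln_div by apply INR_S_pos.
  assert (hx := INR_S_pos n); rewrite (S_INR (S n)).
  set (x := INR (S n)) in *.
  assert (hx1 : 1 <= x) by (unfold x; rewrite S_INR; assert (h := pos_INR n); lra).
  replace ((x + 1) / x) with (1 + / x) by (field; lra).
  assert (hi : 0 < / x) by (apply Rinv_0_lt_compat; lra).
  assert (hi1 : / x <= 1) by (rewrite <- Rinv_1; apply Rinv_le_contravar; lra).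
  rewrite Rabs_pos_eq.
  - apply Rle_trans with (ln (exp 1)); [ | rewrite ln_exp; apply Rle_refl].
    assert (h := exp_ineq1_le 1); apply ln_le; lra.
  - apply Rle_trans with (ln 1); [rewrite ln_1; apply Rle_refl | apply ln_le; lra]. }
(* The exponent adds the error B for p_m to the error B + |a| for p_(n+1). *)
exists (exp (2 * B + Rabs a)); split; [apply exp_pos | ]; intros m n.
assert (h3 : forall k, Cmod (cprod b k) = exp (ln (Cmod (cprod b k)))).
{ intros k; rewrite exp_ln; auto. }
rewrite (h3 m), (h3 (S n)); unfold Rpower, Rdiv.
rewrite <- !exp_Ropp, <- !exp_plus.
specialize (hB m); specialize (h2 n).
apply Rabs_le_between in hB; apply Rabs_le_between in h2.
split; apply exp_le_compat; lra.
Qed.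

(** * The inverse of l - C on the space of all sequences *)

Lemma sum_n_Rmult_l (c : R) (u : nat -> R) (n : nat) :
  sum_n (fun k => c * u k) n = c * sum_n u n.
Proof. exact (sum_n_mult_l (K := R_Ring) c u n). Qed.

Lemma sum_n_SC (x : nat -> C) (n : nat) : sum_n x (S n) = (sum_n x n + x (S n))%C.
Proof. exact (sum_Sn x n). Qed.

Lemma sum_n_Cplus (x y : nat -> C) (n : nat) :
  sum_n (fun k => (x k + y k)%C) n = (sum_n x n + sum_n y n)%C :> C.
Proof. exact (sum_n_plus x y n). Qed.

Lemma sum_n_Cmult_l (a : C) (x : nat -> C) (n : nat) :
  sum_n (fun k => (a * x k)%C) n = (a * sum_n x n)%C :> C.
Proof. exact (sum_n_mult_l (K := C_Ring) a x n). Qed.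

Lemma Cmod_sum_n (x : nat -> C) (n : nat) :
  Cmod (sum_n x n) <= sum_n (fun k => Cmod (x k)) n.
Proof.
induction n as [ | n IH]; [rewrite !sum_O; apply Rle_refl | ].
rewrite sum_n_SC, sum_Sn; unfold plus; simpl.
apply Rle_trans with (1 := Cmod_triangle _ _); lra.
Qed.

(* Multiplying [l x_n - s_n / (n+1) = y_n] by [p_n / l] turns it into
   [p_(n+1) s_n = p_n s_(n-1) + p_n y_n / l]. *)
Lemma resolvent_partial_sums (l : C) (x y : nat -> C) :
  l <> RtoC 0 -> (forall k, (l * x k - cesaro x k)%C = y k) ->
  forall n, (cprod (/ l) (S n) * sum_n x n)%C
    = (/ l * sum_n (fun j => (cprod (/ l) j * y j)%C) n)%C.
Proof.
intros hl h; unfold cesaro in h.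
induction n as [ | n IH].
- rewrite !sum_O; specialize (h O); rewrite sum_O in h; simpl in h |- *; rewrite <- h.
  field; exact hl.
- rewrite (sum_n_SC (fun j => (cprod (/ l) j * y j)%C)), Cmult_plus_distr_l, <- IH.
  change (cprod (/ l) (S (S n))) with (cprod (/ l) (S n) * (1 - / l / RtoC (INR (S (S n)))))%C.
  rewrite <- h, sum_n_SC; field; split; [apply RtoC_INR_S_neq0 | exact hl].
Qed.

(** The solution x_k of l x_k - s_k/(k+1) = y_k, where b = 1/l and s_k is replaced by its closed
    form in y. *)
Definition cesaro_resolvent (b : C) (y : nat -> C) (k : nat) : C :=
  (b * (y k + b * (sum_n (fun j => (cprod b j * y j)%C) k / cprod b (S k)) / RtoC (INR (S k))))%C.

(** Checks that the partial sums of the candidate are the s_n from which it was built, so that it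
    really solves the equation. *)
Lemma sum_cesaro_resolvent (b : C) (y : nat -> C) (n : nat) :
  (forall k, b <> RtoC (INR (S k))) ->
  sum_n (cesaro_resolvent b y) n
    = (b * (sum_n (fun j => (cprod b j * y j)%C) n / cprod b (S n)))%C :> C.
Proof.
intros hb.
assert (hp : forall k, cprod b k <> RtoC 0) by (intros k; apply cprod_neq0; auto).
assert (hf : forall k, (RtoC (INR (S k)) - b)%C <> RtoC 0).
{ intros k e; apply (hb k), eq_sym, Ceq_minus, e. }
induction n as [ | n IH].
- rewrite sum_O; unfold cesaro_resolvent; rewrite sum_O.
  specialize (hf O); simpl in hf |- *; field; exact hf.
- rewrite sum_n_SC, IH; unfold cesaro_resolvent; rewrite !sum_n_SC.
  change (cprod b (S (S n))) with (cprod b (S n) * (1 - b / RtoC (INR (S (S n)))))%C.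
  field; repeat split; auto using RtoC_INR_S_neq0.
Qed.

(** Existence and uniqueness of solutions hold for arbitrary sequences. What remains for the
    resolvent set is whether the formula acts boundedly on l1(w). *)
Lemma cesaro_resolvent_iff (l : C) (x y : nat -> C) :
  l <> RtoC 0 -> (forall k, (/ l)%C <> RtoC (INR (S k))) ->
  (forall k, (l * x k - cesaro x k)%C = y k)
  <-> (forall k, x k = cesaro_resolvent (/ l) y k).
Proof.
intros hl hb; split; intros h.
- assert (h1 := resolvent_partial_sums l x y hl h); intros k.
  assert (hp : cprod (/ l) (S k) <> RtoC 0) by (apply cprod_neq0; auto).
  assert (hs : sum_n x k = (/ l * (sum_n (fun j => (cprod (/ l) j * y j)%C) k / cprod (/ l) (S k)))%C :> C).
  { assert (hd : forall p s z : C, p <> RtoC 0 -> (p * s = z)%C -> s = (z / p)%C).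
    { intros p s z h2 h3; rewrite <- h3; field; exact h2. }
    rewrite (hd _ _ _ hp (h1 k)); apply eq_sym, Cmult_assoc. }
  unfold cesaro_resolvent; rewrite <- hs, <- h; unfold cesaro.
  field; split; [apply RtoC_INR_S_neq0 | exact hl].
- intros k; unfold cesaro; rewrite (sum_n_ext _ _ _ h), sum_cesaro_resolvent by exact hb.
  rewrite h; unfold cesaro_resolvent; field.
  repeat split; auto using RtoC_INR_S_neq0; apply cprod_neq0; auto.
Qed.

(** * Boundedness of the inverse on l1(w) *)

(* Summation by parts against the tails of [g]. *)
Lemma weighted_partial_sums_le (g q : nat -> R) (n : nat) :
  (forall k, 0 <= g k) -> (forall k, 0 <= q k) -> ex_series g ->
  sum_n (fun k => g k * sum_n q k) n
    <= sum_n (fun k => q k * Series (fun j => g (k + j)%nat)) n.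
Proof.
intros hg hq e.
set (G := fun k => Series (fun j => g (k + j)%nat)).
assert (eG : forall k, ex_series (fun j => g (k + j)%nat)).
{ intros k; apply (ex_series_incr_n g k), e. }
assert (hG : forall k, G k = g k + G (S k)).
{ intros k; unfold G; rewrite Series_incr_1 by apply eG.
  rewrite Nat.add_0_r; f_equal; apply Series_ext; intros j; f_equal; lia. }
(* An exact identity; its boundary term is nonnegative and is dropped at the end. *)
assert (h : sum_n (fun k => g k * sum_n q k) n + G (S n) * sum_n q n
   = sum_n (fun k => q k * G k) n).
{ induction n as [ | n IH].
  - rewrite !sum_O, (hG O); ring.
  - rewrite !sum_Sn; unfold plus; simpl; rewrite <- IH, (hG (S n)); ring. }
change (sum_n (fun k => g k * sum_n q k) n <= sum_n (fun k => q k * G k) n); rewrite <- h.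
assert (h1 : forall a : nat -> R, (forall k, 0 <= a k) -> 0 <= sum_n a n).
{ intros a ha; clear -ha; induction n as [ | n IH].
  - rewrite sum_O; apply ha.
  - apply Rle_trans with (1 := IH), sum_n_nonneg_incr, ha. }
assert (h2 : 0 <= G (S n)).
{ apply Rle_trans with (2 := sum_n_le_Series _ O (fun j => hg _) (eG (S n))).
  rewrite sum_O; apply hg. }
assert (h3 := Rmult_le_pos _ _ h2 (h1 q hq)); lra.
Qed.

(** Put r_k = (k+1)^(Re b), g_k = w_k r_k/(k+1) and q_j = |y_j|/r_j. By [cprod_ratio], w_k |x_k| is
    at most |b| w_k |y_k| + c g_k (q_0 + ... + q_k). Summing over k first replaces the second term
    by the q_k weighted with tails of g, which the hypothesis bounds by multiples of r_k w_k; the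
    powers r_k then cancel. *)
Lemma cesaro_resolvent_bounded (w : weight) (b : C) (M : R) :
  (forall k, b <> RtoC (INR (S k))) -> 0 <= M ->
  (forall k n, sum_n (fun j => w (S k + j)%nat * Rpower (INR (S (S k + j))) (Re b)
                     / INR (S (S k + j))) n
     <= M * (Rpower (INR (S k)) (Re b) * w k)) ->
  exists M', 0 < M' /\ forall y, in_ell1 w y ->
    in_ell1 w (cesaro_resolvent b y) /\
    Series (fun k => w k * Cmod (cesaro_resolvent b y k))
      <= M' * Series (fun k => w k * Cmod (y k)).
Proof.
intros hb hM hs.
set (r := fun k => Rpower (INR (S k)) (Re b)).
assert (hr : forall k, 0 < r k) by (intros k; apply Rpower_pos).
assert (hw := weight_pos w).
set (g := fun k => w k * r k / INR (S k)).
assert (hg : forall k, 0 <= g k).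
{ intros k; unfold g; apply Rdiv_le_0_compat; [ | apply INR_S_pos].
  specialize (hw k); specialize (hr k); nra. }
assert (hs' : forall k, ex_series (fun j => g (S k + j)%nat) /\
  Series (fun j => g (S k + j)%nat) <= M * (r k * w k)).
{ intros k; apply nonneg_series_bounded; [intros j; apply hg | intros n; exact (hs k n)]. }
(* The tail bound at k = 0 covers all terms of g but the first. *)
assert (eg : ex_series g) by (apply (ex_series_incr_1 g); exact (proj1 (hs' O))).
(* The hypothesis concerns the tail strictly beyond k; the term g_k itself is at most r_k w_k, which
   turns M into 1 + M. *)
assert (hG : forall k, Series (fun j => g (k + j)%nat) <= (1 + M) * (r k * w k)).
{ intros k; rewrite Series_incr_1 by (apply (ex_series_incr_n g k), eg).
  rewrite Nat.add_0_r.
  rewrite (Series_ext _ (fun j => g (S k + j)%nat)) by (intros j; f_equal; lia).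
  assert (h := proj2 (hs' k)).
  assert (h1 : g k <= r k * w k); [ | lra].
  unfold g; apply (Rmult_le_reg_r (INR (S k))); [apply INR_S_pos | ].
  unfold Rdiv; rewrite Rmult_assoc, Rinv_l by (assert (hx := INR_S_pos k); lra).
  assert (hx := pos_INR k); rewrite S_INR.
  assert (h2 := Rmult_lt_0_compat _ _ (hr k) (hw k)); nra. }
destruct (cprod_ratio b hb) as [K [hK hKr]].
assert (hB := Cmod_ge_0 b).
assert (hp : forall k, 0 < Cmod (cprod b k)).
{ intros k; apply Cmod_gt_0, cprod_neq0; auto. }
set (c := Cmod b ^ 2 * K).
assert (hc : 0 <= c) by (unfold c; nra).
(* |b| comes from the term y_k, c (1 + M) from the sum; the leading 1 makes the constant strictly
   positive. *)
exists (1 + (Cmod b + c * (1 + M))); split; [nra | ]; intros y hy.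
set (q := fun k => Cmod (y k) / r k).
assert (hq : forall k, 0 <= q k) by (intros k; apply Rdiv_le_0_compat; auto using Cmod_ge_0).
assert (hpt : forall k, w k * Cmod (cesaro_resolvent b y k)
   <= Cmod b * (w k * Cmod (y k)) + c * (g k * sum_n q k)).
{ intros k; unfold cesaro_resolvent.
  rewrite Cmod_mult.
  assert (h1 : Cmod (sum_n (fun j => cprod b j * y j)%C k / cprod b (S k)) <= K * r k * sum_n q k).
  { rewrite Cmod_div by (apply Cmod_gt_0; auto).
    apply (Rmult_le_reg_r (Cmod (cprod b (S k)))); [auto | ].
    unfold Rdiv; rewrite Rmult_assoc, Rinv_l, Rmult_1_r by (specialize (hp (S k)); lra).
    apply Rle_trans with (1 := Cmod_sum_n _ _).
    replace (K * r k * sum_n q k * Cmod (cprod b (S k)))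
      with (K * r k * Cmod (cprod b (S k)) * sum_n q k) by ring.
    rewrite <- sum_n_Rmult_l.
    apply sum_n_m_le; intros j; rewrite Cmod_mult; unfold q.
    apply Rle_trans with (K * (r k / r j) * Cmod (cprod b (S k)) * Cmod (y j));
      [ | apply Req_le; unfold Rdiv; ring].
    apply Rmult_le_compat_r; [apply Cmod_ge_0 | ].
    assert (h1 := proj1 (hKr j k)).
    apply (Rmult_le_compat_r (Cmod (cprod b (S k)))) in h1; [ | left; auto].
    unfold Rdiv in h1 at 1; rewrite Rmult_assoc, Rinv_l, Rmult_1_r in h1
      by (specialize (hp (S k)); lra).
    exact h1. }
  assert (h2 : Cmod (b * (sum_n (fun j => cprod b j * y j)%C k / cprod b (S k)) / RtoC (INR (S k)))
     <= Cmod b * (K * r k * sum_n q k) / INR (S k)).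
  { rewrite Cmod_div by apply RtoC_INR_S_neq0.
    rewrite Cmod_mult, Cmod_R, Rabs_pos_eq by apply pos_INR.
    apply Rmult_le_compat_r; [left; apply Rinv_0_lt_compat, INR_S_pos | ].
    apply Rmult_le_compat_l; assumption. }
  apply Rle_trans with
    (w k * (Cmod b * (Cmod (y k) + Cmod b * (K * r k * sum_n q k) / INR (S k)))).
  - apply Rmult_le_compat_l; [left; auto | ].
    apply Rmult_le_compat_l; [assumption | ].
    apply Rle_trans with (1 := Cmod_triangle _ _); lra.
  - apply Req_le; unfold c, g; field; assert (hx := INR_S_pos k); lra. }
set (Y := Series (fun k => w k * Cmod (y k))).
assert (hYn : forall n, sum_n (fun k => w k * Cmod (y k)) n <= Y).
{ intros n; apply sum_n_le_Series; [intros k; apply ell1_term_ge0 | exact hy]. }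
assert (hY : 0 <= Y).
{ apply Rle_trans with (2 := hYn O); rewrite sum_O; apply ell1_term_ge0. }
assert (hR : ex_series (fun k => w k * Cmod (cesaro_resolvent b y k)) /\
   Series (fun k => w k * Cmod (cesaro_resolvent b y k)) <= (Cmod b + c * (1 + M)) * Y).
{ apply nonneg_series_bounded; [intros k; apply ell1_term_ge0 | intros n].
  apply Rle_trans with (1 := sum_n_m_le _ _ _ _ hpt).
  change (sum_n (fun k => plus (Cmod b * (w k * Cmod (y k))) (c * (g k * sum_n q k))) n
    <= (Cmod b + c * (1 + M)) * Y).
  rewrite sum_n_plus, !sum_n_Rmult_l; unfold plus; simpl.
  assert (h1 : sum_n (fun k => g k * sum_n q k) n <= (1 + M) * Y).
  { apply Rle_trans with (1 := weighted_partial_sums_le g q n hg hq eg).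
    apply Rle_trans with ((1 + M) * sum_n (fun k => w k * Cmod (y k)) n).
    - rewrite <- sum_n_Rmult_l; apply sum_n_m_le; intros k.
      apply Rle_trans with (q k * ((1 + M) * (r k * w k))).
      + apply Rmult_le_compat_l; auto.
      + apply Req_le; unfold q; field; specialize (hr k); lra.
    - apply Rmult_le_compat_l; [lra | apply hYn]. }
  specialize (hYn n).
  assert (h2 := Rmult_le_compat_l _ _ _ hB hYn).
  assert (h3 := Rmult_le_compat_l _ _ _ hc h1).
  lra. }
split; [exact (proj1 hR) | ].
apply Rle_trans with (1 := proj2 hR); nra.
Qed.

(** * The supremum condition as inequalities between real numbers *)

Lemma Rpower_1_minus (x a : R) : 0 < x -> Rpower x (1 - a) = x / Rpower x a.
Proof.
intros hx; unfold Rminus; rewrite Rpower_plus, Rpower_Ropp, Rpower_1 by exact hx; reflexivity.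
Qed.

(** As c > 0, the product in [Rbar] is never 0 times infinity, so it is the limit of c times the
    partial sums even when infinite. These increase, so a bound on the limit is a bound on each of
    them. *)
Lemma nonneg_series_scal_le_iff (a : nat -> R) (c K : R) :
  (forall k, 0 <= a k) -> 0 < c ->
  Rbar_le (Rbar_mult (Finite c) (nonneg_series a)) (Finite K)
  <-> forall n, c * sum_n a n <= K.
Proof.
intros ha hc; unfold nonneg_series.
assert (hinc := sum_n_nonneg_incr a ha).
assert (hl := Lim_seq_correct _ (ex_lim_seq_incr _ hinc)).
assert (hcp : is_Rbar_mult (Finite c) (Lim_seq (sum_n a))
   (Rbar_mult (Finite c) (Lim_seq (sum_n a)))).
{ apply Rbar_mult_correct; simpl; destruct (Lim_seq (sum_n a)); simpl; lra. }
assert (hcl := is_lim_seq_mult _ _ _ _ _ (is_lim_seq_const c) hl hcp).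
split.
- intros h n.
  destruct (Rbar_mult (Finite c) (Lim_seq (sum_n a))) as [l | | ]; simpl in h; [ | tauto | ].
  + apply Rle_trans with (2 := h).
    apply (is_lim_seq_incr_compare (fun n => c * sum_n a n)); [exact hcl | ].
    intros k; apply Rmult_le_compat_l; [lra | apply hinc].
  + exfalso; apply (is_lim_seq_le (fun _ => c * sum_n a O) (fun n => c * sum_n a n)
      (Finite (c * sum_n a O)) m_infty); [ | apply is_lim_seq_const | exact hcl].
    intros k; apply Rmult_le_compat_l; [lra | ].
    induction k as [ | k IH]; [apply Rle_refl | apply Rle_trans with (1 := IH), hinc].
- intros h; apply (is_lim_seq_le (fun n => c * sum_n a n) (fun _ => K));
    [exact h | exact hcl | apply is_lim_seq_const].
Qed.

Lemma Sup_seq_lt_p_infty_iff (u : nat -> Rbar) :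
  Rbar_lt (Sup_seq u) p_infty
  <-> exists K : R, 0 <= K /\ forall n, Rbar_le (u n) (Finite K).
Proof.
split.
- intros h.
  assert (hK : exists K : R, 0 <= K /\ Rbar_le (Sup_seq u) (Finite K)).
  { destruct (Sup_seq u) as [l | | ]; simpl in h; [ | tauto | ].
    - exists (Rmax 0 l); split; [apply Rmax_l | apply Rmax_r].
    - exists 0; split; [apply Rle_refl | exact I]. }
  destruct hK as [K [h0 hK]]; exists K; split; [exact h0 | intros n].
  apply Rbar_not_lt_le; intros h1; apply (Rbar_le_not_lt _ _ hK).
  apply Sup_seq_minor_lt; exists n; exact h1.
- intros [K [_ hK]].
  apply Rbar_le_lt_trans with (Finite K); [ | exact I].
  apply Rbar_not_lt_le; intros h; apply Sup_seq_minor_lt in h; destruct h as [n h].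
  exact (Rbar_le_not_lt _ _ (hK n) h).
Qed.

(** Removes extended reals and infinite sums from the criterion and writes 1/n^(1-a) as n^a/n, the
    shape met in the columns of the inverse. *)
Lemma resolvent_sup_lt_p_infty_iff (w : weight) (a : R) :
  Rbar_lt (resolvent_sup w a) p_infty
  <-> exists M, 0 <= M /\ forall k n,
    sum_n (fun j => w (S k + j)%nat * Rpower (INR (S (S k + j))) a / INR (S (S k + j))) n
      <= M * (Rpower (INR (S k)) a * w k).
Proof.
unfold resolvent_sup; rewrite Sup_seq_lt_p_infty_iff.
assert (he : forall k j, w (S k + j)%nat / Rpower (INR (S (S k + j))) (1 - a)
   = w (S k + j)%nat * Rpower (INR (S (S k + j))) a / INR (S (S k + j))).
{ intros k j; rewrite Rpower_1_minus by apply INR_S_pos.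
  assert (h1 := INR_S_pos (S k + j)); assert (h2 := Rpower_pos (INR (S (S k + j))) a).
  field; lra. }
assert (hn : forall k j, 0 <= w (S k + j)%nat / Rpower (INR (S (S k + j))) (1 - a)).
{ intros k j; apply Rdiv_le_0_compat; [left; apply weight_pos | apply Rpower_pos]. }
assert (hc : forall k, 0 < Rpower (INR (S k)) a * w k).
{ intros k; apply Rmult_lt_0_compat; [apply Rpower_pos | apply weight_pos]. }
assert (hd : forall M k s, 1 / (Rpower (INR (S k)) a * w k) * s <= M
   <-> s <= M * (Rpower (INR (S k)) a * w k)).
{ intros M k s; specialize (hc k); set (d := Rpower (INR (S k)) a * w k) in *; split; intros h.
  - apply (Rmult_le_compat_r d) in h; [ | lra].
    replace (1 / d * s * d) with s in h by (field; lra); exact h.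
  - apply (Rmult_le_reg_r d); [exact hc | ].
    replace (1 / d * s * d) with s by (field; lra); exact h. }
assert (hp : forall k, 0 < 1 / (Rpower (INR (S k)) a * w k)).
{ intros k; apply Rdiv_lt_0_compat; [lra | apply hc]. }
split; intros [M [hM h]]; exists M; split; try exact hM.
- intros k n; rewrite <- (sum_n_ext _ _ _ (he k)); apply hd.
  exact (proj1 (nonneg_series_scal_le_iff _ _ _ (hn k) (hp k)) (h k) n).
- intros k; apply nonneg_series_scal_le_iff; [apply hn | apply hp | intros n].
  apply hd; rewrite (sum_n_ext _ _ _ (he k)); apply h.
Qed.

(** * Unit vectors in l1(w) *)

Lemma sum_n_single {G : AbelianMonoid} (j : nat) (v : G) (n : nat) :
  sum_n (fun i => if Nat.eq_dec i j then v else zero) n = if le_dec j n then v else zero.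
Proof.
induction n as [ | n IH].
- rewrite sum_O; destruct (Nat.eq_dec 0 j), (le_dec j 0); (reflexivity || lia).
- rewrite sum_Sn, IH.
  destruct (Nat.eq_dec (S n) j), (le_dec j n), (le_dec j (S n)); try lia;
    [apply plus_zero_l | apply plus_zero_r | apply plus_zero_r].
Qed.

Definition unit_seq (j k : nat) : C := if Nat.eq_dec k j then RtoC 1 else RtoC 0.

Lemma sum_n_mult_unit_seq (u : nat -> C) (j n : nat) :
  sum_n (fun i => (u i * unit_seq j i)%C) n = (if le_dec j n then u j else RtoC 0) :> C.
Proof.
rewrite (sum_n_ext _ (fun i => if Nat.eq_dec i j then u j else zero)).
- exact (sum_n_single j (u j) n).
- intros i; unfold unit_seq; destruct (Nat.eq_dec i j) as [-> | d]; [apply Cmult_1_r | apply Cmult_0_r].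
Qed.

Lemma unit_seq_norm (w : weight) (j : nat) :
  in_ell1 w (unit_seq j) /\ Series (fun k => w k * Cmod (unit_seq j k)) <= w j.
Proof.
apply nonneg_series_bounded; [intros k; apply ell1_term_ge0 | intros n].
assert (hj := weight_pos w j).
rewrite (sum_n_ext _ (fun i => if Nat.eq_dec i j then w j else zero)).
- rewrite sum_n_single; destruct (le_dec j n); unfold zero; simpl; lra.
- intros i; unfold unit_seq; destruct (Nat.eq_dec i j) as [-> | d];
    [rewrite Cmod_1; apply Rmult_1_r | rewrite Cmod_0; apply Rmult_0_r].
Qed.

Definition unit_ell1 (w : weight) (j : nat) : ell1 w := Ell1 (unit_seq j) (proj1 (unit_seq_norm w j)).

(** * The resolvent set of the Cesàro operator *)

Section CesaroEll1.

Variables (w : weight) (hC : forall x : nat -> C, in_ell1 w x -> in_ell1 w (cesaro x)).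

Let T := cesaro_ell1 w hC.

Lemma resolvent_equation (l : C) (x y : ell1 w) :
  minus (scal l x) (T x) = y <-> forall k, (l * x k - cesaro x k)%C = y k.
Proof.
split; [intros <- k; reflexivity | intros h; apply ell1_ext; exact h].
Qed.

(** Testing a bounded inverse on unit vectors suffices both to exclude the points of [Sigma0] and to
    derive the supremum condition. *)
Lemma resolvent_on_unit_vectors (l : C) :
  resolvent_set T l ->
  exists M, 0 < M /\ forall j, exists x : ell1 w,
    (forall k, (l * x k - cesaro x k)%C = unit_seq j k) /\ ell1_norm w x <= M * w j.
Proof.
intros [S [[_ _ [M [hM hn]]] [_ hS]]]; exists M; split; [exact hM | intros j].
exists (S (unit_ell1 w j)); split.
- apply (resolvent_equation l (S (unit_ell1 w j)) (unit_ell1 w j)), hS.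
- apply Rle_trans with (1 := hn (unit_ell1 w j)).
  apply Rmult_le_compat_l; [lra | apply unit_seq_norm].
Qed.

(** For l = 0 the preimage x of the unit vector e_k has s_n = 0 for n <> k and s_k = -(k+1), so
    |x_k| = k + 1. The norm bound would give k + 1 <= M, which fails for large k. *)
Lemma not_resolvent_0 : ~ resolvent_set T (RtoC 0).
Proof.
intros h; destruct (resolvent_on_unit_vectors _ h) as [M [hM hx]].
destruct (INR_unbounded M) as [k hk].
destruct (hx k) as [x [he hn]].
assert (hs : forall n, sum_n x n = (- (RtoC (INR (S n)) * unit_seq k n))%C :> C).
{ assert (hf : forall d s a : C, d <> RtoC 0 -> s = (- (d * (RtoC 0 * a - s / d)))%C).
  { intros d s a hd; field; exact hd. }
  intros n; rewrite <- he; apply hf, RtoC_INR_S_neq0. }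
assert (hxk : Cmod (x k) = INR (S k)).
{ assert (e : x k = (- RtoC (INR (S k)))%C).
  { assert (hk1 := hs k); unfold unit_seq in hk1.
    destruct (Nat.eq_dec k k) as [_ | d]; [ | congruence].
    rewrite Cmult_1_r in hk1; rewrite <- hk1.
    destruct k as [ | k]; [symmetry; apply sum_O | ].
    rewrite sum_n_SC, (hs k); unfold unit_seq.
    destruct (Nat.eq_dec k (S k)) as [d | _]; [lia | ring]. }
  rewrite e, Cmod_opp, Cmod_R; apply Rabs_pos_eq, pos_INR. }
assert (h1 := ell1_term_le_norm w x k); rewrite hxk in h1.
assert (h2 : w k * INR (S k) <= w k * M) by lra.
apply Rmult_le_reg_l in h2; [ | apply weight_pos].
rewrite S_INR in h2; lra.
Qed.

(** Here 1/l = m + 1, so p_(m+1) = 0 while p_m is nonzero. In the identity for s_m with y = e_m, the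
    left side vanishes and the right side is p_m / l, so e_m has no preimage. *)
Lemma not_resolvent_Sigma (m : nat) : ~ resolvent_set T (RtoC (1 / INR (S m))).
Proof.
intros h; destruct (resolvent_on_unit_vectors _ h) as [M [hM hx]].
destruct (hx m) as [x [he _]].
assert (hm := INR_S_pos m).
set (l := RtoC (1 / INR (S m))) in *.
assert (hl : l <> RtoC 0).
{ intros e; apply RtoC_inj in e.
  assert (h1 : 0 < 1 / INR (S m)) by (apply Rdiv_lt_0_compat; lra); lra. }
assert (hinv : (/ l)%C = RtoC (INR (S m))).
{ unfold l; rewrite <- RtoC_inv by (assert (h1 : 0 < 1 / INR (S m)) by (apply Rdiv_lt_0_compat; lra); lra).
  f_equal; field; lra. }
assert (h1 := resolvent_partial_sums l x _ hl he m).
rewrite sum_n_mult_unit_seq, hinv in h1.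
destruct (le_dec m m) as [_ | d]; [ | lia].
assert (h2 : cprod (RtoC (INR (S m))) (S m) = RtoC 0).
{ change (cprod (RtoC (INR (S m))) m * (1 - RtoC (INR (S m)) / RtoC (INR (S m))) = 0)%C.
  field; apply RtoC_INR_S_neq0. }
rewrite h2, Cmult_0_l in h1; symmetry in h1; revert h1.
apply Cmult_neq_0; [apply RtoC_INR_S_neq0 | ].
apply cprod_neq0; intros j hj e; apply RtoC_inj, INR_eq in e; lia.
Qed.

Lemma resolvent_of_tail_bound (l : C) (M : R) :
  l <> RtoC 0 -> (forall k, (/ l)%C <> RtoC (INR (S k))) -> 0 <= M ->
  (forall k n, sum_n (fun j => w (S k + j)%nat * Rpower (INR (S (S k + j))) (Re (/ l))
                     / INR (S (S k + j))) n
     <= M * (Rpower (INR (S k)) (Re (/ l)) * w k)) ->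
  resolvent_set T l.
Proof.
intros hl hb hM hs.
destruct (cesaro_resolvent_bounded w (/ l) M hb hM hs) as [M' [hM' hR]].
set (S := fun y : ell1 w => Ell1 (cesaro_resolvent (/ l) y) (proj1 (hR y (ell1_in y)))).
assert (hS1 : forall y, minus (scal l (S y)) (T (S y)) = y).
{ intros y; apply resolvent_equation; apply cesaro_resolvent_iff; auto. }
(* Uniqueness of solutions: additivity and homogeneity of S then follow by checking that the
   expected value solves the equation. *)
assert (hS2 : forall x y : ell1 w, minus (scal l x) (T x) = y -> S y = x).
{ intros x y h; apply ell1_ext; intros k; symmetry.
  revert k; apply (cesaro_resolvent_iff l x y hl hb), resolvent_equation, h. }
exists S; split; [apply Build_is_linear | split].
- intros x y; apply hS2, resolvent_equation; intros k.
  assert (hx := proj1 (resolvent_equation _ _ _) (hS1 x) k).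
  assert (hy := proj1 (resolvent_equation _ _ _) (hS1 y) k).
  change (plus x y k) with (x k + y k)%C; rewrite <- hx, <- hy.
  change (plus (S x) (S y) k) with (S x k + S y k)%C; unfold cesaro.
  change (sum_n (plus (S x) (S y)) k) with (sum_n (fun j => (S x j + S y j)%C) k).
  rewrite sum_n_Cplus; field; apply RtoC_INR_S_neq0.
- intros a x; apply hS2, resolvent_equation; intros k.
  assert (hx := proj1 (resolvent_equation _ _ _) (hS1 x) k).
  change (scal a x k) with (a * x k)%C; rewrite <- hx.
  change (scal a (S x) k) with (a * S x k)%C; unfold cesaro.
  change (sum_n (scal a (S x)) k) with (sum_n (fun j => (a * S x j)%C) k).
  rewrite sum_n_Cmult_l; field; apply RtoC_INR_S_neq0.
- exists M'; split; [exact hM' | intros x; exact (proj2 (hR x (ell1_in x)))].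
- intros x; apply hS2; reflexivity.
- exact hS1.
Qed.

(** Below the diagonal, the entry of column k of the inverse in row i is b^2 p_k / ((i+1) p_(i+1)).
    The norm of this column is at most M w_k, and [cprod_ratio] turns the ratio of products into a
    ratio of powers. *)
Lemma tail_bound_of_resolvent (l : C) :
  l <> RtoC 0 -> (forall k, (/ l)%C <> RtoC (INR (S k))) ->
  resolvent_set T l ->
  exists M, 0 <= M /\
  forall k n, sum_n (fun j => w (S k + j)%nat * Rpower (INR (S (S k + j))) (Re (/ l))
                     / INR (S (S k + j))) n
     <= M * (Rpower (INR (S k)) (Re (/ l)) * w k).
Proof.
intros hl hb h.
destruct (resolvent_on_unit_vectors l h) as [M [hM hx]].
destruct (cprod_ratio (/ l) hb) as [K [hK hKr]].
set (b := (/ l)%C) in *.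
assert (hb0 : 0 < Cmod b).
{ unfold b; rewrite Cmod_inv by exact hl; apply Rinv_0_lt_compat, Cmod_gt_0, hl. }
(* K pays for replacing the products by powers; |b|^2 is the factor in front of every entry below
   the diagonal. *)
set (c := K / Cmod b ^ 2).
assert (hc : 0 < c) by (apply Rdiv_lt_0_compat; [exact hK | apply pow_lt, hb0]).
exists (c * M); split; [nra | intros k n].
destruct (hx k) as [x [he hn]].
assert (hxe := proj1 (cesaro_resolvent_iff l x _ hl hb) he); fold b in hxe.
set (rk := Rpower (INR (S k)) (Re b)).
assert (hrk : 0 < rk) by apply Rpower_pos.
apply Rle_trans with (sum_n (fun j => c * rk * (w (S k + j)%nat * Cmod (x (S k + j)%nat))) n).
- apply sum_n_m_le; intros j.
  set (i := (S k + j)%nat).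
  assert (hxi : Cmod (x i) = Cmod b ^ 2 * (Cmod (cprod b k) / Cmod (cprod b (S i))) / INR (S i)).
  { rewrite hxe; unfold cesaro_resolvent; rewrite sum_n_mult_unit_seq.
    unfold unit_seq; destruct (Nat.eq_dec i k) as [d | _]; [unfold i in d; lia | ].
    destruct (le_dec k i) as [_ | d]; [ | unfold i in d; lia].
    rewrite Cplus_0_l, Cmod_mult, Cmod_div, Cmod_mult, Cmod_div, Cmod_R, Rabs_pos_eq.
    - unfold Rdiv; ring.
    - apply pos_INR.
    - apply cprod_neq0; auto.
    - apply RtoC_INR_S_neq0. }
  assert (h1 := proj2 (hKr k i)); fold rk in h1.
  rewrite hxi; unfold c.
  assert (hi := INR_S_pos i); assert (hw := weight_pos w i).
  set (P := Cmod (cprod b k) / Cmod (cprod b (S i))) in *.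
  apply Rle_trans with (w i / INR (S i) * rk * (K * P)).
  + replace (w i * Rpower (INR (S i)) (Re b) / INR (S i))
      with (w i / INR (S i) * rk * (Rpower (INR (S i)) (Re b) / rk)) by (field; lra).
    apply Rmult_le_compat_l; [ | exact h1].
    apply Rmult_le_pos; [ | lra]; apply Rdiv_le_0_compat; lra.
  + apply Req_le; field; lra.
- rewrite sum_n_Rmult_l.
  assert (h1 := sum_n_shift_le_Series (fun i => w i * Cmod (x i)) (S k) n
     (ell1_term_ge0 w x) (ell1_in x)).
  fold (ell1_norm w x) in h1.
  assert (h2 := Rle_trans _ _ _ h1 hn).
  apply Rle_trans with (c * rk * (M * w k)); [ | apply Req_le; ring].
  apply Rmult_le_compat_l; [nra | exact h2].
Qed.
End CesaroEll1.

(** * Falling factorials and their growth *)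

(** Subtraction is real, without truncation; for k < m the product contains the factor k - k and
    vanishes. *)
Fixpoint falling (m k : nat) : R :=
  match m with
  | O => 1
  | S m => falling m k * (INR k - INR m)
  end.

Lemma falling_S (m k : nat) : falling (S m) k = falling m k * (INR k - INR m).
Proof. reflexivity. Qed.

(** The recurrence that the eigenvalue equation for 1/(m+1) imposes on consecutive entries. *)
Lemma falling_step (m k : nat) :
  (INR (S k) - INR m) * falling m (S k) = INR (S k) * falling m k.
Proof.
induction m as [ | m IH]; [simpl; ring | ].
rewrite !falling_S.
replace (_ * _) with ((INR (S k) - INR m) * falling m (S k) * (INR (S k) - INR (S m))) by ring.
rewrite IH, !S_INR; ring.
Qed.

(** The hockey-stick identity for binomial coefficients, multiplied by m!. Divided by k + 1, it is
    the eigenvalue equation for 1/(m+1). *)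
Lemma sum_n_falling (m k : nat) : sum_n (falling m) k = INR (S k) / INR (S m) * falling m k :> R.
Proof.
assert (hm := INR_S_pos m).
induction k as [ | k IH].
- rewrite sum_O; destruct m as [ | m]; [simpl; field | ].
  assert (h : falling (S m) 0 = 0).
  { clear; induction m as [ | m IH]; rewrite falling_S; [simpl; ring | rewrite IH; ring]. }
  rewrite h; ring.
- rewrite sum_Sn, IH; change plus with Rplus.
  transitivity ((INR (S k) * falling m k + INR (S m) * falling m (S k)) / INR (S m)); [field; lra | ].
  rewrite <- falling_step, !S_INR; rewrite S_INR in hm; field; lra.
Qed.

Lemma falling_upper (m : nat) :
  exists c, 0 < c /\ forall k, Rabs (falling m k) <= c * Rpower (INR (S k)) (INR m).
Proof.
induction m as [ | m [c [hc IH]]].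
- exists 1; split; [lra | intros k]; simpl; rewrite Rpower_O, Rabs_R1 by apply INR_S_pos; lra.
- exists (c * INR (S m)); split; [apply Rmult_lt_0_compat; auto using INR_S_pos | intros k].
  rewrite falling_S, Rabs_mult, (S_INR m), Rpower_plus, Rpower_1 by apply INR_S_pos.
  apply Rle_trans with ((c * Rpower (INR (S k)) (INR m)) * ((INR m + 1) * INR (S k)));
    [ | apply Req_le; ring].
  apply Rmult_le_compat; auto using Rabs_pos.
  rewrite S_INR; assert (h1 := pos_INR m); assert (h2 := pos_INR k).
  apply Rabs_le; split; nra.
Qed.

Lemma falling_lower (m : nat) :
  exists c, 0 < c /\ forall k, (m <= k)%nat -> Rpower (INR (S k)) (INR m) <= c * falling m k.
Proof.
induction m as [ | m [c [hc IH]]].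
- exists 1; split; [lra | intros k _]; simpl; rewrite Rpower_O by apply INR_S_pos; lra.
(* For k >= m + 1 the new factor satisfies k + 1 <= (m+2)(k-m), since the difference is
   (m+1)(k-m-1). *)
- exists (c * INR (S (S m))); split; [apply Rmult_lt_0_compat; auto using INR_S_pos | intros k hk].
  rewrite falling_S, (S_INR m), Rpower_plus, Rpower_1 by apply INR_S_pos.
  apply Rle_trans with ((c * falling m k) * (INR (S (S m)) * (INR k - INR m)));
    [ | apply Req_le; ring].
  apply Rmult_le_compat; [left; apply Rpower_pos | apply pos_INR | apply IH; lia | ].
  apply le_INR in hk; rewrite !S_INR in *; assert (h1 := pos_INR m); nra.
Qed.

Lemma falling_pos (m k : nat) : (m <= k)%nat -> 0 < falling m k.
Proof.
intros h; destruct (falling_lower m) as [c [hc hl]].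
specialize (hl k h); assert (h1 := Rpower_pos (INR (S k)) (INR m)).
apply (Rmult_lt_reg_l c); lra.
Qed.

Lemma in_ell1_falling (w : weight) (m : nat) :
  R_w w (INR m) -> in_ell1 w (fun k => RtoC (falling m k)).
Proof.
intros h; destruct (falling_upper m) as [c [_ hc]].
apply in_ell1_dominated with (b := fun k => c * Rpower (INR (S k)) (INR m)).
- intros k; rewrite Cmod_R; apply hc.
- apply ex_series_ext with (fun k => scal c (Rpower (INR (S k)) (INR m) * w k)).
  + intros k; unfold scal; simpl; unfold mult; simpl; ring.
  + apply (ex_series_scal (K := R_AbsRing) (V := R_NormedModule)), h.
Qed.

(** Turns membership of an eigenvector in l1(w) into a moment condition on w. The lower bound on
    [falling] starts at index m, so convergence is shown for the tail from m on. *)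
Lemma R_w_of_falling_le (w : weight) (x : nat -> C) (m : nat) (c : R) :
  in_ell1 w x -> (forall k, (m <= k)%nat -> falling m k <= c * Cmod (x k)) -> R_w w (INR m).
Proof.
intros hx h; destruct (falling_lower m) as [d [hd hl]].
apply (ex_series_incr_n _ m).
apply (ex_series_le (K := R_AbsRing) (V := R_CompleteNormedModule))
  with (fun j => scal (d * c) (w (m + j)%nat * Cmod (x (m + j)%nat))).
- intros j.
  change (Rabs (Rpower (INR (S (m + j))) (INR m) * w (m + j)%nat)
    <= d * c * (w (m + j)%nat * Cmod (x (m + j)%nat))).
  assert (hw := weight_pos w (m + j)); assert (hp := Rpower_pos (INR (S (m + j))) (INR m)).
  rewrite Rabs_pos_eq by nra.
  specialize (h (m + j)%nat ltac:(lia)); specialize (hl (m + j)%nat ltac:(lia)).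
  apply (Rmult_le_compat_l d) in h; [ | lra].
  apply Rle_trans with (d * (c * Cmod (x (m + j)%nat)) * w (m + j)%nat); [ | apply Req_le; ring].
  apply Rmult_le_compat_r; lra.
- apply (ex_series_scal (K := R_AbsRing) (V := R_NormedModule)).
  exact (proj1 (ex_series_incr_n (fun k => w k * Cmod (x k)) m) hx).
Qed.

(** * Eigenvectors and the point spectrum *)

Lemma sum_n_RtoC (u : nat -> R) (n : nat) :
  sum_n (fun k => RtoC (u k)) n = RtoC (sum_n u n) :> C.
Proof.
induction n as [ | n IH]; [now rewrite !sum_O | ].
rewrite sum_n_SC, IH, sum_Sn; symmetry; apply RtoC_plus.
Qed.

Lemma first_nonzero (x : nat -> C) :
  (exists k, x k <> RtoC 0) -> exists m, x m <> RtoC 0 /\ forall k, (k < m)%nat -> x k = RtoC 0.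
Proof.
intros [n hn]; revert hn; induction n as [n IH] using (well_founded_induction lt_wf); intros hn.
destruct (classic (exists k, (k < n)%nat /\ x k <> RtoC 0)) as [[k [hk hx]] | h].
- exact (IH k hk hx).
- exists n; split; [exact hn | intros k hk].
  apply NNPP; intros hx; apply h; exists k; auto.
Qed.

Lemma sum_n_leading_zeros (x : nat -> C) (m : nat) :
  (forall k, (k < m)%nat -> x k = RtoC 0) -> sum_n x m = x m :> C.
Proof.
intros h.
assert (hz : forall n, (n < m)%nat -> sum_n x n = RtoC 0 :> C).
{ induction n as [ | n IH]; intros hn; [rewrite sum_O; auto | ].
  rewrite sum_n_SC, IH, h by lia; apply Cplus_0_l. }
destruct m as [ | m]; [apply sum_O | ].
rewrite sum_n_SC, hz by lia; apply Cplus_0_l.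
Qed.

(** At the first nonzero entry s_m = x_m, which forces l = 1/(m+1). Subtracting the equations s_k =
    (k+1)/(m+1) x_k for consecutive k gives the recurrence of [falling_step], which determines x
    from x_m. *)
Lemma cesaro_eigenvector (x : nat -> C) (l : C) (m : nat) :
  (forall k, cesaro x k = (l * x k)%C) ->
  x m <> RtoC 0 -> (forall k, (k < m)%nat -> x k = RtoC 0) ->
  l = RtoC (1 / INR (S m)) /\
  forall k, (m <= k)%nat -> (RtoC (falling m m) * x k = RtoC (falling m k) * x m)%C.
Proof.
intros he hm hz.
assert (hSm := RtoC_INR_S_neq0 m).
assert (hl : l = (/ RtoC (INR (S m)))%C).
{ specialize (he m); unfold cesaro in he; rewrite sum_n_leading_zeros in he by exact hz.
  replace l with (l * x m / x m)%C by (field; exact hm).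
  rewrite <- he; field; split; assumption. }
split.
{ rewrite hl; unfold Rdiv; rewrite Rmult_1_l, RtoC_inv; [reflexivity | ].
  assert (h := INR_S_pos m); lra. }
assert (hs : forall k, sum_n x k = (RtoC (INR (S k)) * / RtoC (INR (S m)) * x k)%C :> C).
{ assert (hf : forall d s z : C, d <> RtoC 0 -> (s / d)%C = z -> s = (d * z)%C).
  { intros d s z hd <-; field; exact hd. }
  intros k; rewrite <- Cmult_assoc, <- hl; apply hf; [apply RtoC_INR_S_neq0 | apply he]. }
assert (hr : forall k, (RtoC (INR (S k) - INR m) * x (S k) = RtoC (INR (S k)) * x k)%C).
{ intros k; assert (h := hs (S k)); rewrite sum_n_SC, hs in h.
  replace (RtoC (INR (S k)) * x k)%C
    with (RtoC (INR (S m)) * (RtoC (INR (S k)) * / RtoC (INR (S m)) * x k + x (S k))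
      - RtoC (INR (S m)) * x (S k))%C by (field; exact hSm).
  rewrite h, RtoC_minus, (S_INR (S k)), (S_INR m), !RtoC_plus.
  rewrite S_INR, RtoC_plus in hSm; field; exact hSm. }
intros k hk; replace k with (m + (k - m))%nat by lia.
induction (k - m)%nat as [ | j IH]; [rewrite Nat.add_0_r; reflexivity | ].
rewrite Nat.add_succ_r.
(* This coefficient equals j + 1, so the recurrence can be solved for the next entry. *)
assert (hd : RtoC (INR (S (m + j)) - INR m) <> RtoC 0).
{ intros e; apply RtoC_inj in e; rewrite S_INR, plus_INR in e.
  assert (h := pos_INR j); lra. }
assert (hf := falling_step m (m + j)); apply (f_equal RtoC) in hf; rewrite !RtoC_mult in hf.
specialize (hr (m + j)%nat).
set (d := RtoC (INR (S (m + j)) - INR m)) in *.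
replace (RtoC (falling m m) * x (S (m + j)))%C
  with (RtoC (falling m m) * (d * x (S (m + j))) / d)%C by (field; exact hd).
rewrite hr.
replace (RtoC (falling m (S (m + j))) * x m)%C
  with (d * RtoC (falling m (S (m + j))) * x m / d)%C by (field; exact hd).
rewrite hf.
replace (RtoC (falling m m) * (RtoC (INR (S (m + j))) * x (m + j)%nat) / d)%C
  with (RtoC (INR (S (m + j))) * (RtoC (falling m m) * x (m + j)%nat) / d)%C by (field; exact hd).
rewrite IH; field; exact hd.
Qed.

(** Here m counts from 0: the eigenvalue is 1/(m+1), and the condition on m - 1 for the eigenvalue
    1/m becomes one on m. *)
Lemma point_spectrum_cesaro_iff (w : weight)
  (hC : forall x : nat -> C, in_ell1 w x -> in_ell1 w (cesaro x)) (l : C) :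
  point_spectrum (cesaro_ell1 w hC) l
  <-> exists m : nat, R_w w (INR m) /\ l = RtoC (1 / INR (S m)).
Proof.
split.
- intros [x [hx he]].
  assert (he' : forall k, cesaro x k = (l * x k)%C).
  { intros k; exact (f_equal (fun z : ell1 w => z k) he). }
  destruct (first_nonzero x) as [m [hm hz]].
  { apply NNPP; intros h; apply hx, ell1_ext; intros k; apply NNPP; intros hk.
    apply h; exists k; exact hk. }
  destruct (cesaro_eigenvector x l m he' hm hz) as [hl hr].
  exists m; split; [ | exact hl].
  assert (hxm := proj1 (Cmod_gt_0 _) hm).
  apply (R_w_of_falling_le w x m (falling m m / Cmod (x m)) (ell1_in x)).
  intros k hk; apply Req_le.
  assert (h := f_equal Cmod (hr k hk)); rewrite !Cmod_mult, !Cmod_R in h.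
  rewrite !Rabs_pos_eq in h by (left; apply falling_pos; lia).
  apply (Rmult_eq_reg_r (Cmod (x m))); [ | lra].
  rewrite <- h; field; lra.
- intros [m [hR ->]].
  exists (Ell1 _ (in_ell1_falling w m hR)); split.
  + intros e; apply (f_equal (fun z : ell1 w => z m)) in e; simpl in e.
    apply RtoC_inj in e; assert (h := falling_pos m m (le_n m)); lra.
  + apply ell1_ext; intros k; change (cesaro (fun k => RtoC (falling m k)) k
      = (RtoC (1 / INR (S m)) * RtoC (falling m k))%C).
    assert (hm := INR_S_pos m); assert (hk := INR_S_pos k).
    unfold cesaro; rewrite sum_n_RtoC, sum_n_falling, <- RtoC_div, <- RtoC_mult by lra.
    f_equal; field; lra.
Qed.

(** * The set [R_w] and the assembly of the three statements *)

Lemma R_w_le (w : weight) (s t : R) : s <= t -> R_w w t -> R_w w s.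
Proof.
intros h; apply (ex_series_le (K := R_AbsRing) (V := R_CompleteNormedModule)); intros k.
change (Rabs (Rpower (INR (S k)) s * w k) <= Rpower (INR (S k)) t * w k).
assert (hw := weight_pos w k); assert (hp := Rpower_pos (INR (S k)) s).
rewrite Rabs_pos_eq by nra.
apply Rmult_le_compat_r; [lra | ].
apply Rle_Rpower; [rewrite S_INR; assert (h1 := pos_INR k); lra | exact h].
Qed.

(** [R_w] is closed downwards, so any t outside it is an upper bound. Conversely, if every real
    belongs to it, the supremum t can be neither finite, as t + 1 is a member, nor -oo, as 0 is. *)
Lemma not_R_w_all_iff (w : weight) :
  ~ (forall t : R, R_w w t) <-> Rbar_lt (t_0 w) p_infty.
Proof.
destruct (Lub_Rbar_correct (R_w w)) as [hub hlub]; fold (t_0 w) in hub, hlub.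
split.
- intros h; apply not_all_ex_not in h; destruct h as [t ht].
  apply Rbar_le_lt_trans with (Finite t); [ | exact I].
  apply hlub; intros s hs; simpl.
  destruct (Rle_dec s t) as [h1 | h1]; [exact h1 | ].
  exfalso; apply ht, (R_w_le w t s); [lra | exact hs].
- intros h hall; destruct (t_0 w) as [t | | ]; simpl in h; [ | tauto | ].
  + specialize (hub (t + 1) (hall _)); simpl in hub; lra.
  + exact (hub 0 (hall 0)).
Qed.

Lemma Sigma_S_iff (l : C) : Sigma l <-> exists m, l = RtoC (1 / INR (S m)).
Proof.
split.
- intros [[ | m] [h ->]]; [lia | now exists m].
- intros [m ->]; exists (S m); split; [lia | reflexivity].
Qed.

Theorem theorem3p7
  (w : weight)
  (hC : forall x : nat -> C, in_ell1 w x -> in_ell1 w (cesaro x))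
  (hL : is_linear (cesaro_ell1 w hC)) :
  let T : ell1 w -> ell1 w := cesaro_ell1 w hC in
  (* (i) *)
  ((forall l : C, Sigma l -> Sigma0 l) /\
   (forall l : C, Sigma0 l -> spectrum T l)) /\
  (* (ii) *)
  (forall l : C, ~ Sigma0 l ->
     let alpha := Re (/ l)%C in
     resolvent_set T l <-> Rbar_lt (resolvent_sup w alpha) p_infty) /\
  (* (iii) *)
  ((~ (forall t : R, R_w w t)) <-> Rbar_lt (t_0 w) p_infty) /\
  (~ (forall t : R, R_w w t) ->
     (forall l : C,
        (exists m : nat, (1 <= m)%nat /\ R_w w (INR m - 1) /\ l = RtoC (1 / INR m))
        <-> point_spectrum T l) /\
     (forall l : C, point_spectrum T l ->
        exists m : nat, (1 <= m)%nat /\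
          Rbar_le (Finite (INR m)) (Rbar_plus (t_0 w) (Finite 1)) /\
          l = RtoC (1 / INR m)) /\
     (exists s : list C, forall l : C, point_spectrum T l -> In l s) /\
     (forall l : C, point_spectrum T l -> Sigma l)) /\
  ((forall t : R, R_w w t) ->
     forall l : C, point_spectrum T l <-> Sigma l).
Proof.
intros T; unfold T.
split; [split | split; [ | split; [ | split]]].
- intros l h; left; exact h.
- intros l [h | ->]; [ | apply not_resolvent_0].
  apply Sigma_S_iff in h; destruct h as [m ->]; apply not_resolvent_Sigma.
- intros l hl; cbv zeta.
  assert (hl0 : l <> RtoC 0) by (intros e; apply hl; right; exact e).
  assert (hb : forall k, (/ l)%C <> RtoC (INR (S k))).
  { intros k e; apply hl; left; apply Sigma_S_iff; exists k.
    assert (hk := INR_S_pos k).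
    unfold Rdiv; rewrite Rmult_1_l, RtoC_inv, <- e by lra; field; exact hl0. }
  rewrite resolvent_sup_lt_p_infty_iff; split.
  + now apply tail_bound_of_resolvent.
  + intros [M [hM h]]; now apply (resolvent_of_tail_bound w hC l M).
- apply not_R_w_all_iff.
- intros hall; split; [ | split; [ | split]].
  + intros l; rewrite point_spectrum_cesaro_iff; split.
    * intros [[ | m] [h1 [h2 h3]]]; [lia | exists m; split; [ | exact h3]].
      rewrite S_INR in h2; replace (INR m) with (INR m + 1 - 1) by ring; exact h2.
    * intros [m [h1 h2]]; exists (S m); split; [lia | split; [ | exact h2]].
      rewrite S_INR; replace (INR m + 1 - 1) with (INR m) by ring; exact h1.
  + intros l h; apply point_spectrum_cesaro_iff in h; destruct h as [m [h1 h2]].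
    exists (S m); split; [lia | split; [ | exact h2]].
    assert (h3 := proj1 (Lub_Rbar_correct (R_w w)) _ h1); fold (t_0 w) in h3.
    rewrite S_INR; destruct (t_0 w); simpl in h3 |- *; [lra | exact I | exact h3].
  + apply not_all_ex_not in hall; destruct hall as [t ht].
    (* With t outside [R_w] and n > t, no m >= n lies in [R_w], so only 1/1, ..., 1/n can be
       eigenvalues. *)
    destruct (INR_unbounded t) as [n hn].
    exists (map (fun m => RtoC (1 / INR (S m))) (seq 0 n)); intros l h.
    apply point_spectrum_cesaro_iff in h; destruct h as [m [h1 ->]].
    apply (in_map (fun m => RtoC (1 / INR (S m)))), in_seq; split; [lia | ].
    destruct (le_lt_dec n m) as [h2 | h2]; [ | exact h2].
    exfalso; apply ht, (R_w_le w t (INR m)); [ | exact h1].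
    apply le_INR in h2; lra.
  + intros l h; apply point_spectrum_cesaro_iff in h; destruct h as [m [_ h2]].
    apply Sigma_S_iff; exists m; exact h2.
- intros hall l; rewrite point_spectrum_cesaro_iff, Sigma_S_iff; split.
  + intros [m [_ h]]; exists m; exact h.
  + intros [m h]; exists m; split; [apply hall | exact h].
Qed.
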